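(* There are positive constants $c$ and $n_0$ such that for every $n\geq n_0$ there exists a tree $T_n$ with $n$ vertices and maximum degree $\Delta(T_n)\leq \frac{cn}{\log(n)}$ such that in the Client-Waiter game on $K_n$, Waiter can prevent Client from claiming a red copy of $T_n$.
   Context: In the unbiased Client-Waiter game on $K_n$, the board is the edge set of the complete graph $K_n$. In each round Waiter offers Client two previously unclaimed edges; Client chooses one of them, which he keeps (colored red), and the other goes to Waiter (colored blue). If in the final round only one unclaimed edge remains, it goes to Client. Client wins if at the end his red graph contains a copy of $T_n$; otherwise Waiter wins. *)

(* Defs.v *)
From mathcomp Require Import all_boot.
From Stdlib Require Import Reals.

Set Implicit Arguments.
Unset Strict Implicit.
Unset Printing Implicit Defensive.

Section Defs.
Variable n : nat.

Definition board : {set {set 'I_n}} := [set e : {set 'I_n} | #|e| == 2].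

Definition adj (E : {set {set 'I_n}}) : rel 'I_n :=
  fun x y => (x != y) && ([set x; y] \in E).

Definition connected_graph (E : {set {set 'I_n}}) : Prop :=
  forall x y : 'I_n, connect (adj E) x y.

Definition acyclic (E : {set {set 'I_n}}) : Prop :=
  forall c : seq 'I_n, uniq c -> 3 <= size c -> ~~ cycle (adj E) c.

Definition is_tree (E : {set {set 'I_n}}) : Prop :=
  E \subset board /\ connected_graph E /\ acyclic E.

Definition deg (E : {set {set 'I_n}}) (v : 'I_n) : nat :=
  #|[set e in E | v \in e]|.

Definition has_copy (T G : {set {set 'I_n}}) : Prop :=
  exists f : 'I_n -> 'I_n, injective f /\ forall e, e \in T -> f @: e \in G.

(* ww k T R F : Waiter has a winning strategy (i.e. can prevent a red copy of T)
   from the position where R is Client's red edge set and F is the set of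
   unclaimed edges; k is fuel (at least #|F|). In each round Waiter offers two
   distinct unclaimed edges, Client picks one (red), the other becomes blue
   (blue edges play no further role). If fewer than two edges remain, the
   remaining (at most one) edge goes to Client and the game ends. *)
Fixpoint ww (k : nat) (T R F : {set {set 'I_n}}) : Prop :=
  match k with
  | 0 => ~ has_copy T (R :|: F)
  | k'.+1 =>
      if 2 <= #|F| then
        exists e1 e2 : {set 'I_n},
          [/\ e1 \in F, e2 \in F, e1 != e2,
              ww k' T (e1 |: R) (F :\ e1 :\ e2) &
              ww k' T (e2 |: R) (F :\ e1 :\ e2)]
      else ~ has_copy T (R :|: F)
  end.

Definition waiter_wins (T : {set {set 'I_n}}) : Prop :=
  ww #|board| T set0 board.

End Defs.

(* Main.v *)
(** The tree is a q-ary heap with q about n / k and k about (log2 n) / 8: its k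
    lowest labels dominate all other vertices, so a red copy yields a red
    dominating set of size k.  Waiter derandomises the fact that G(n, 1/2) has
    no such set.  His potential is the number of pairs (S, D) where S is a set
    of unclaimed edges and D a k-set dominating the red graph plus S.  If x and
    y are not two edges from the same vertex to D, then giving Client exactly
    one of x and y is, on average, no better for D than giving him both or none
    with equal odds.  As each D has at most n k^2 pairs (x, y) violating this
    condition, Waiter can, among M unclaimed edges, offer two of nearly equal
    effect on the potential with few such D, so that whatever Client chooses the
    expected count (potential / 2^M) grows by a factor at most
    1 + O(k sqrt n / M).  The total growth exp(O(k sqrt n log n)) is absorbed by
    the initial value, below n^k (1 - 2^-k)^(n - k). *)

Require Import Defs.
From mathcomp Require Import all_boot zify.
From Stdlib Require Import Reals Lra.
From mathcomp Require Import ssrnat.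

Set Implicit Arguments.
Unset Strict Implicit.
Unset Printing Implicit Defensive.

(** * Potential functions and nearly balanced offers *)

(** This is [2 ^ #|F|] times the expectation of [h] when each edge of [F] turns red with probability
    1/2, unnormalised to stay in [nat]. *)
Definition mass (E : finType) (h : {set E} -> nat) (R F : {set E}) : nat :=
  \sum_(S in powerset F) h (R :|: S).

Lemma mass_split (E : finType) (h : {set E} -> nat) (R F : {set E}) e :
  e \in F -> mass h R F = mass h R (F :\ e) + mass h (e |: R) (F :\ e).
Proof.
move=> eF; rewrite /mass (bigID (fun S : {set E} => e \notin S)) /=.
congr (_ + _); first by apply: eq_bigl => S; rewrite !inE subsetD1.
rewrite (reindex_onto (fun S => e |: S) (fun S => S :\ e)) /=; last first.
  by move=> S /andP[_ /negPn eS]; rewrite setD1K.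
apply: eq_big => [S|S _]; last by rewrite setUCA setUA.
rewrite !inE subUset sub1set eF eqxx /= andbT subsetD1; congr (_ && _).
by apply/eqP/idP => [<-|/setU1K //]; rewrite !inE eqxx.
Qed.

(** With bucket sizes [m j], sum [2 * g * m j <= m j ^ 2 + g ^ 2] over the buckets. *)
Lemma same_bucket_pairs (E : finType) (s g : nat) (b : E -> 'I_s)
    (F : {set E}) :
  2 * g * #|F| <=
    \sum_(x in F) \sum_(y in F) ((x != y) && (b x == b y)) + #|F| + s * g ^ 2.
Proof.
pose m (j : 'I_s) := #|[set x in F | b x == j]|.
have mE j : m j = \sum_(x in F | b x == j) 1.
  by rewrite /m -sum1_card; apply: eq_bigl => x; rewrite inE.
have cardE : #|F| = \sum_j m j.
  rewrite -[LHS]sum1_card (partition_big b xpredT) //=.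
  by apply: eq_bigr => j _; rewrite mE.
have -> : \sum_(x in F) \sum_(y in F) ((x != y) && (b x == b y)) + #|F| =
    \sum_j m j * m j.
  rewrite -[X in _ + X]sum1_card -big_split (partition_big b xpredT) //=.
  apply: eq_bigr => j _; rewrite {1}mE big_distrl /=.
  apply: eq_bigr => x /andP[xF /eqP <-]; rewrite mul1n mE.
  rewrite (bigD1 x) //= eqxx add0n [RHS](bigD1 x) ?xF ?eqxx //= addnC.
  congr (_ + _); rewrite [RHS]big_mkcond [LHS]big_mkcond /=.
  apply: eq_bigr => y _; rewrite [y == x]eq_sym [b y == _]eq_sym.
  by case: (y \in F); case: (x == y); case: (b x == b y).
have -> : s * g ^ 2 = \sum_(j < s) g ^ 2 by rewrite sum_nat_const card_ord.
rewrite -big_split cardE big_distrr /=; apply: leq_sum => j _.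
by rewrite -mulnA mulnn addnC; apply: (nat_Cauchy g (m j)).1.
Qed.

(** Pigeonhole plus averaging: cutting [[0, X]] into about [#|F| / (2 * g)] intervals leaves at
    least [#|F| * g] ordered pairs with close values of [beta]. As [w] totals at most
    [4 * g ^ 2 * X], one of them has weight at most [4 * g * X / #|F|]. *)
Lemma close_pair (E : finType) (F : {set E}) (beta : E -> nat)
    (w : E -> E -> nat) (X W g : nat) :
  (forall x, x \in F -> beta x <= X) ->
  \sum_(x in F) \sum_(y in F) w x y <= W * X ->
  W <= 4 * g ^ 2 -> 8 <= g -> 8 * g < 3 * #|F| ->
  exists x y, [/\ x \in F, y \in F, x != y, #|F| * w x y <= 4 * g * X &
    #|F| * beta x <= #|F| * beta y + 2 * g * X /\
    #|F| * beta y <= #|F| * beta x + 2 * g * X].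
Proof.
set M := #|F| => betaX wX Wg g8 gM.
pose s := M %/ (2 * g) + 1.
have sM : M <= 2 * g * s.
  by rewrite /s addn1 ltnW // mulnC -ltn_divLR ?ltnS //; lia.
have sg : s * g ^ 2 * 2 <= M * g + 2 * g ^ 2.
  have : M %/ (2 * g) * (2 * g) <= M := leq_divM _ _.
  rewrite /s; nia.
have s_gt0 : 0 < s by rewrite /s addn1.
(* Truncation at [X] keeps the bucket index in range outside [F], where [betaX] says nothing. *)
have ltb x : (minn (beta x) X * s) %/ X.+1 < s.
  by rewrite ltn_divLR // mulnC ltn_pmul2l // ltnS geq_minr.
pose b x := Ordinal (ltb x).
pose good x y := (x != y) && (b x == b y).
have := same_bucket_pairs g b F; rewrite -/M.
set P := \sum_(x in F) _ => leP.
(* Here [8 <= g] bounds [M] by [M * g / 8], and [8 * g < 3 * M] bounds [g ^ 2] by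
   [3 * M * g / 8]. *)
have PM : M * g <= P by nia.
have [/existsP[x /existsP[y /and4P[xF yF /andP[xy /eqP bxy] wxy]]]|none] :=
    boolP [exists x, exists y, [&& x \in F, y \in F, good x y &
      M * w x y <= 4 * g * X]].
  exists x, y; split=> //.
  have close u v : u \in F -> v \in F -> b u = b v ->
      M * beta u <= M * beta v + 2 * g * X.
    move=> uF vF /(congr1 val) /=.
    rewrite (minn_idPl (betaX _ uF)) (minn_idPl (betaX _ vF)) => buv.
    have us := divn_eq (beta u * s) X.+1; have vs := divn_eq (beta v * s) X.+1.
    have := ltn_pmod (beta u * s) (ltn0Sn X); rewrite ltnS => ur.
    have gap : beta u * s <= beta v * s + X.
      by rewrite us vs buv -addnA leq_add2l (leq_trans ur) ?leq_addl.
    have [uv|uv] := leqP (beta u) (beta v); first nia.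
    have gap' : (beta u - beta v) * s <= X by rewrite mulnBl leq_subLR.
    nia.
  by split; apply: close.
(* If every good pair were too heavy, the total weight would be too large; the successor gives the
   contradiction even for [X = 0]. *)
have wbig : (4 * g * X).+1 * P <= M * (W * X).
  apply: leq_trans (_ : M * \sum_(x in F) \sum_(y in F) w x y <= _); last first.
    by rewrite leq_mul2l wX orbT.
  rewrite !big_distrr /=.
  apply: leq_sum => x xF; rewrite !big_distrr /=.
  apply: leq_sum => y yF.
  case gxy: (_ && _); last by rewrite muln0.
  rewrite muln1 ltnNge; apply: contra none => wxy.
  by apply/existsP; exists x; apply/existsP; exists y; rewrite xF yF /good gxy.
have : 4 * g * X * (M * g) <= 4 * g * X * P by rewrite leq_mul2l PM orbT.
have : M * (W * X) <= M * (4 * g ^ 2 * X) by rewrite leq_mul2l leq_mul2r Wg !orbT.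
nia.
Qed.

(** Split the potential by which of [x] and [y] turn red. [cross] bounds the two mixed parts
    together by half of the potential plus [w x y / 2], and they differ by [beta x - beta y], so
    closeness of [beta] bounds each one. *)
Lemma balanced_pair (J E : finType) (g : J -> {set E} -> bool)
    (conf : J -> rel E) (W a : nat) (R F : {set E}) :
  (forall j (A B : {set E}), A \subset B -> g j A -> g j B) ->
  (forall j x y A, ~~ conf j x y -> g j (x |: A) -> g j (y |: A) -> g j A) ->
  (forall j, \sum_x \sum_y conf j x y <= W) ->
  W <= 4 * a ^ 2 -> 8 <= a -> 1 < #|F| ->
  let Phi := mass (fun G => \sum_j g j G) in
  exists x y, [/\ x \in F, y \in F, x != y,
    4 * #|F| * Phi (x |: R) (F :\ x :\ y) <= Phi R F * (#|F| + 8 * a) &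
    4 * #|F| * Phi (y |: R) (F :\ x :\ y) <= Phi R F * (#|F| + 8 * a)].
Proof.
move=> mono indep confW Wa a8 F2 Phi.
have split4 h x y : x \in F -> y \in F -> x != y ->
    mass h R F = mass h R (F :\ x :\ y) + mass h (y |: R) (F :\ x :\ y)
      + (mass h (x |: R) (F :\ x :\ y)
         + mass h (y |: (x |: R)) (F :\ x :\ y)).
  move=> xF yF xy; rewrite (mass_split _ _ xF).
  by rewrite !(mass_split _ _ (_ : y \in F :\ x)) // !inE eq_sym xy.
(* In the small case [#|F| + 8 * a] is at least [4 * #|F|], so any two edges do. *)
have [small|large] := leqP (3 * #|F|) (8 * a).
  have /card_gt1P[x [y [xF yF xy]]] := F2.
  exists x, y; split=> //; have := split4 (fun G => \sum_j g j G) _ _ xF yF xy;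
    rewrite -/Phi; nia.
pose w x y := mass (fun G => \sum_j conf j x y * g j G) R F.
pose beta x := Phi (x |: R) (F :\ x).
have betaX x : x \in F -> beta x <= Phi R F.
  by move=> xF; rewrite /Phi (mass_split _ _ xF) leq_addl.
(* Double counting: each [(S, j)] counted by the potential carries at most [W] conflicting pairs. *)
have wX : \sum_(x in F) \sum_(y in F) w x y <= W * Phi R F.
  rewrite /w /Phi /mass big_distrr /=.
  under eq_bigr do rewrite exchange_big /=.
  rewrite exchange_big /=; apply: leq_sum => S _.
  under eq_bigr do rewrite exchange_big /=.
  rewrite exchange_big big_distrr /=; apply: leq_sum => j _.
  apply: leq_trans (_ : (\sum_x \sum_y conf j x y) * g j (R :|: S) <= _);
    last first.
    by rewrite leq_mul2r confW orbT.
  rewrite big_distrl [leqLHS]big_mkcond /=; apply: leq_sum => x _.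
  case: ifP => // _; rewrite big_distrl [leqLHS]big_mkcond /=.
  by apply: leq_sum => y _; case: ifP.
have [x [y [xF yF xy wxy [bxy byx]]]] := close_pair betaX wX Wa a8 large.
exists x, y; set F' := F :\ x :\ y.
have bx : beta x = Phi (x |: R) F' + Phi (y |: (x |: R)) F'.
  by rewrite /beta /Phi (mass_split _ _ (_ : y \in F :\ x)) // !inE eq_sym xy.
have by_ : beta y = Phi (y |: R) F' + Phi (y |: (x |: R)) F'.
  rewrite /beta /Phi (mass_split _ _ (_ : x \in F :\ y)) ?inE ?xy //.
  have -> : F :\ y :\ x = F' by rewrite /F' !setDDl setUC.
  by rewrite setUCA.
have PhiE : Phi R F = Phi R F' + Phi (y |: R) F'
    + (Phi (x |: R) F' + Phi (y |: (x |: R)) F').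
  exact: split4.
(* Pointwise, if x alone and y alone both complete the unsatisfied condition j,
   then [conf j x y] must hold. *)
have cross : Phi (x |: R) F' + Phi (y |: R) F' <=
    Phi R F' + Phi (y |: (x |: R)) F' + w x y.
  rewrite [w x y](split4 _ _ _ xF yF xy) -/F'.
  apply: leq_trans (_ : Phi R F' + Phi (y |: (x |: R)) F' +
    mass (fun G => \sum_j conf j x y * g j G) (y |: (x |: R)) F' <= _);
    last by rewrite leq_add2l addnA leq_addl.
  rewrite /Phi /mass -!big_split /=; apply: leq_sum => S _.
  rewrite -!big_split /=; apply: leq_sum => j _.
  have m1 : g j (R :|: S) -> g j (x |: (R :|: S)).
    by apply: mono; rewrite subsetUr.
  have m2 : g j (x |: (R :|: S)) -> g j (y |: (x |: (R :|: S))).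
    by apply: mono; rewrite subsetUr.
  have m3 : g j (y |: (R :|: S)) -> g j (y |: (x |: (R :|: S))).
    by apply: mono; rewrite setUS // subsetUr.
  have := indep j x y (R :|: S); rewrite -!setUA.
  case: (conf j x y) => /=.
    by case: (g j _) m1 m2 m3; do 3?[case: (g j _)]; lia.
  move=> /(_ isT); case: (g j _) m1 m2 m3; do 3?[case: (g j _)] => //=; lia.
split=> //; nia.
Qed.

(** * Waiter's strategy from a small potential *)

Lemma bernoulli_expn x d t : x ^ t * (x + t * d) <= x * (x + d) ^ t.
Proof.
elim: t => [|t IHt]; first by rewrite !expn0 !muln1 mul1n addn0.
rewrite !expnS; move: (x ^ t) ((x + d) ^ t) IHt => u v; nia.
Qed.

(* The factor (#|F| + 2) ^ (4 * a) absorbs all later losses 1 + 8 a / M, since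
   M drops by 2 each round and ((M + 2) / M) ^ (4 a) >= 1 + 8 a / M. *)
Lemma ww_of_mass (n : nat) (T : {set {set 'I_n}}) (J : finType)
    (g : J -> {set {set 'I_n}} -> bool) (conf : J -> rel {set 'I_n})
    (W a : nat) :
  (forall j (A B : {set {set 'I_n}}), A \subset B -> g j A -> g j B) ->
  (forall j x y A, ~~ conf j x y -> g j (x |: A) -> g j (y |: A) -> g j A) ->
  (forall j, \sum_x \sum_y conf j x y <= W) ->
  W <= 4 * a ^ 2 -> 8 <= a ->
  (forall G, has_copy T G -> exists j, g j G) ->
  forall k (R F : {set {set 'I_n}}), #|F| <= k ->
  mass (fun G => \sum_j g j G) R F * (#|F| + 2) ^ (4 * a) < 2 ^ #|F| ->
  ww k T R F.
Proof.
move=> mono indep confW Wa a8 copyP.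
have final (R F : {set {set 'I_n}}) : #|F| <= 1 ->
    mass (fun G => \sum_j g j G) R F * (#|F| + 2) ^ (4 * a) < 2 ^ #|F| ->
    ~ has_copy T (R :|: F).
  move=> F1 small /copyP[j gj].
  (* The term [S = F] makes the potential positive, which [small] forbids once at most one edge is
     left. *)
  have: 0 < mass (fun G => \sum_j g j G) R F.
    rewrite /mass (bigD1 F) ?inE //= (bigD1 j) //= gj.
    by rewrite -addnA.
  have le1 : 2 ^ #|F| <= (#|F| + 2) ^ (4 * a).
    apply: leq_trans (_ : 2 ^ (4 * a) <= _); first by rewrite leq_exp2l //; lia.
    by rewrite leq_exp2r ?leq_addl //; lia.
  move=> m0; have := leq_ltn_trans (leq_pmull _ m0) small.
  by rewrite ltnNge le1.
elim=> [|k IHk] R F leFk small /=;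
  first by apply: final; rewrite ?(leq_trans leFk).
case: ifP => [F2|/negbT]; last by rewrite -leqNgt; move/final; apply.
have [x [y [xF yF xy stepx stepy]]] :=
  balanced_pair R mono indep confW Wa a8 F2.
have cardF' : #|F :\ x :\ y| + 2 = #|F|.
  by rewrite (cardsD1 x F) (cardsD1 y (F :\ x)) xF !inE eq_sym xy yF; lia.
have step R' :
    4 * #|F| * mass (fun G => \sum_j g j G) R' (F :\ x :\ y) <=
      mass (fun G => \sum_j g j G) R F * (#|F| + 8 * a) ->
    ww k T R' (F :\ x :\ y).
  move=> stepR'; apply: IHk; first by move: leFk; lia.
  rewrite cardF'.
  move: (mass _ _ _) (mass _ _ _) stepR' small => m m' stepR' small.
  have F0 : 0 < #|F| by rewrite ltnW.
  (* Two edges leave the board in a round, so the target [2 ^ #|F|] drops by a factor 4. *)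
  rewrite -(ltn_pmul2l (isT : 0 < 2 ^ 2)) -expnD addnC cardF'.
  rewrite -(ltn_pmul2l F0).
  apply: leq_ltn_trans (_ : _ <= #|F| * (m * (#|F| + 2) ^ (4 * a))) _; last first.
    rewrite ltn_pmul2l //; exact: small.
  have := bernoulli_expn #|F| 2 (4 * a).
  move: (#|F| ^ _) ((#|F| + 2) ^ _) => u v.
  have -> : 4 * a * 2 = 8 * a by rewrite mulnAC.
  move=> uv.
  have : m * (u * (#|F| + 8 * a)) <= m * (#|F| * v) by rewrite leq_mul2l uv orbT.
  have : u * (4 * #|F| * m') <= u * (m * (#|F| + 8 * a)).
    by rewrite leq_mul2l stepR' orbT.
  rewrite -[2 ^ 2]/4; nia.
by exists x, y; split=> //; apply: step.
Qed.

(** * Counting red graphs with a small dominating set *)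

(** A uniform random subset of [B] meets disjoint [q]-sets independently, each with probability
    [1 - 2 ^ -q]; the induction peels off one set. *)
Lemma card_hitting_sets (E : finType) (I : eqType) (A : I -> {set E}) (q : nat)
    (s : seq I) (B : {set E}) :
  uniq s -> {in s, forall i, A i \subset B /\ #|A i| = q} ->
  {in s &, forall i j, i != j -> [disjoint A i & A j]} ->
  #|[set S in powerset B | all (fun i => S :&: A i != set0) s]|
    * 2 ^ (q * size s) <= (2 ^ q - 1) ^ size s * 2 ^ #|B|.
Proof.
elim: s B => [|i s IHs] B /=.
  move=> _ _ _; rewrite muln0 !expn0 muln1 mul1n -card_powerset.
  by apply: subset_leq_card; apply/subsetP => S; rewrite inE => /andP[].
move=> /andP[i_s us] AB dis.
have [AiB cAi] := AB i (mem_head _ _).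
have dis_i j : j \in s -> [disjoint A j & A i].
  move=> js; apply: dis; rewrite ?inE ?eqxx ?js ?orbT //.
  by apply: contraNneq i_s => <-.
set N := #|[set S in powerset B | _]|.
pose N' := #|[set S in powerset (B :\: A i) |
               all (fun j => S :&: A j != set0) s]|.
have IH : N' * 2 ^ (q * size s) <= (2 ^ q - 1) ^ size s * 2 ^ #|B :\: A i|.
  apply: (IHs _ us) => [j js|j k js ks];
    last by apply: dis; rewrite inE ?js ?ks orbT.
  have jis : j \in i :: s by rewrite inE js orbT.
  have [AjB cAj] := AB j jis.
  by split=> //; rewrite subsetD AjB dis_i.
have cB : #|B| = q + #|B :\: A i|.
  by rewrite -(cardsID (A i) B) (setIidPr AiB) cAi.
have NN' : N <= (2 ^ q - 1) * N'.
  have <- : #|powerset (A i) :\ set0| = 2 ^ q - 1.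
    by rewrite -cAi -card_powerset [in RHS](cardsD1 set0)
      powersetE sub0set add1n subn1.
  rewrite -cardsX.
  (* A hitting set is determined by its nonempty trace on [A i] and by the rest, which still hits
     the other sets. *)
  pose f (S : {set E}) := (S :&: A i, S :\: A i).
  rewrite /N -(card_imset _ (_ : injective f)); last first.
    by move=> S S' [e1 e2]; rewrite -(setID S (A i)) e1 e2 setID.
  apply: subset_leq_card; apply/subsetP => _ /imsetP[S + ->].
  rewrite !inE /= => /andP[SB /andP[Si /allP Ss]].
  rewrite Si subsetIr setSD //=; apply/allP => j js.
  have := Ss j js; congr (_ != set0).
  by rewrite setIDAC setDE -setIA; congr (_ :&: _); apply/esym/setIidPl;
    rewrite -disjoints_subset dis_i.
rewrite cB mulnS !expnD expnS [leqRHS]mulnCA [leqLHS]mulnCA leq_mul2l.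
apply/orP; right; apply: leq_trans (leq_mul NN' (leqnn _)) _.
by rewrite -!mulnA leq_mul2l IH orbT.
Qed.

Definition spokes (n : nat) (D : {set 'I_n}) (v : 'I_n) : {set {set 'I_n}} :=
  [set [set v; d] | d in D].

Definition dominates (n : nat) (D : {set 'I_n}) (G : {set {set 'I_n}}) : bool :=
  [forall v, (v \notin D) ==> (G :&: spokes D v != set0)].

Lemma dominatesS n (D : {set 'I_n}) (A B : {set {set 'I_n}}) :
  A \subset B -> dominates D A -> dominates D B.
Proof.
move=> AB /forallP domA; apply/forallP => v; apply/implyP => vD.
have /set0Pn[e eA] := implyP (domA v) vD.
by apply/set0Pn; exists e; apply: (subsetP (setSI _ AB)).
Qed.

Lemma card_spokes n (D : {set 'I_n}) v : v \notin D -> #|spokes D v| = #|D|.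
Proof.
move=> vD; apply: card_in_imset => d d' dD d'D /setP/(_ d).
by rewrite !inE eqxx orbT => /esym/orP[/eqP dv|/eqP //]; rewrite -dv dD in vD.
Qed.

Lemma spokes_board n (D : {set 'I_n}) v :
  v \notin D -> spokes D v \subset board n.
Proof.
move=> vD; apply/subsetP => _ /imsetP[d dD ->]; rewrite inE cards2.
by case: (v =P d) vD => // ->; rewrite dD.
Qed.

Lemma disjoint_spokes n (D : {set 'I_n}) v w :
  v \notin D -> w \notin D -> v != w -> [disjoint spokes D v & spokes D w].
Proof.
move=> vD wD vw; apply/pred0P => e /=; apply/negP.
case/andP=> /imsetP[d dD ->] /imsetP[d' d'D /setP/(_ v)].
rewrite !inE eqxx (negPf vw) /= => /esym/eqP vd'.
by rewrite vd' d'D in vD.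
Qed.

Definition same_spokes (n : nat) (D : {set 'I_n}) : rel {set 'I_n} :=
  fun x y => [exists v, (x \in spokes D v) && (y \in spokes D v)].

(** If [v] is undominated in [A], then [x] and [y] must both be spokes at [v], which is a
    conflict. *)
Lemma dominates_cross n (D : {set 'I_n}) x y A : ~~ same_spokes D x y ->
  dominates D (x |: A) -> dominates D (y |: A) -> dominates D A.
Proof.
move=> xy /forallP domx /forallP domy; apply/forallP => v; apply/implyP => vD.
have /set0Pn[e] := implyP (domx v) vD; have /set0Pn[e'] := implyP (domy v) vD.
rewrite !inE => /andP[/orP[/eqP e'y|e'A] e'v]; last first.
  by move=> _; apply/set0Pn; exists e'; rewrite inE e'A.
case/andP=> [/orP[/eqP ex|eA] ev]; last first.
  by apply/set0Pn; exists e; rewrite inE eA.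
by case/existsP: xy; exists v; rewrite -ex -e'y ev.
Qed.

(** Union bound over the centre [v], with at most [#|D| ^ 2] pairs of spokes each. *)
Lemma sum_same_spokes n (D : {set 'I_n}) :
  \sum_x \sum_y same_spokes D x y <= n * #|D| ^ 2.
Proof.
rewrite pair_big /=.
apply: leq_trans (_ : \sum_(p : {set 'I_n} * {set 'I_n}) \sum_v
  ((p.1 \in spokes D v) && (p.2 \in spokes D v)) <= _).
  apply: leq_sum => -[x y] _ /=.
  rewrite /same_spokes; case: existsP => // -[v xyv]; rewrite (bigD1 v) //= xyv.
  by rewrite leq_addr.
rewrite exchange_big /=.
have -> : n * #|D| ^ 2 = \sum_(v < n) #|D| ^ 2.
  by rewrite sum_nat_const card_ord.
apply: leq_sum => v _.
rewrite -big_mkcond /= sum1_card.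
apply: leq_trans (_ : #|setX (spokes D v) (spokes D v)| <= _).
  by apply: subset_leq_card; apply/subsetP => p; rewrite !inE.
by rewrite cardsX mulnn leq_exp2r // leq_imset_card.
Qed.

(** For fixed [D] the spokes at the [n - k] outside vertices form disjoint [k]-sets, all of which a
    dominating graph must hit. *)
Lemma sum_dominating n (k : nat) :
  (\sum_(S in powerset (board n)) \sum_(D : {set 'I_n})
     ((#|D| == k) && dominates D S)) * 2 ^ (k * (n - k))
  <= 'C(n, k) * (2 ^ k - 1) ^ (n - k) * 2 ^ #|board n|.
Proof.
rewrite exchange_big big_distrl /=.
have -> : 'C(n, k) = #|[set D : {set 'I_n} | #|D| == k]|.
  by rewrite card_draws card_ord.
rewrite -mulnA -sum_nat_const [leqRHS]big_mkcond /=; apply: leq_sum => D _.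
rewrite inE; case: eqP => [Dk|_] /=; last by rewrite big1.
pose s := enum (~: D).
have ss : size s = n - k by rewrite -cardE cardsCs setCK Dk card_ord.
have sD v : v \in s = (v \notin D) by rewrite mem_enum inE.
have spokesP : {in s, forall v, spokes D v \subset board n /\ #|spokes D v| = k}.
  by move=> v; rewrite sD => vD; rewrite spokes_board // card_spokes.
have dis : {in s &, forall v w, v != w -> [disjoint spokes D v & spokes D w]}.
  by move=> v w; rewrite !sD; apply: disjoint_spokes.
have := card_hitting_sets (enum_uniq _) spokesP dis.
rewrite ss; apply: leq_trans.
rewrite leq_mul2r; apply/orP; right.
rewrite -sum1_card big_mkcond [leqRHS]big_mkcond /=; apply: leq_sum => S _.
rewrite !inE; case: (S \subset _) => //=.
case domS: (dominates D S) => //=; rewrite ifT //.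
apply/allP => v; rewrite sD => vD; exact: (implyP (forallP domS v) vD).
Qed.

Lemma waiter_wins_of_dominating n (T : {set {set 'I_n}}) (k a : nat) :
  1 < n -> n * k ^ 2 <= 4 * a ^ 2 -> 8 <= a ->
  'C(n, k) * (2 ^ k - 1) ^ (n - k) * (n ^ 2) ^ (4 * a) < 2 ^ (k * (n - k)) ->
  (forall G, has_copy T G -> exists D : {set 'I_n}, #|D| = k /\ dominates D G) ->
  waiter_wins T.
Proof.
move=> n1 nka a8 small copyP.
(* The conflict relation also tests [#|D| == k], so that the bound [n * k ^ 2] holds for every index
   [D]. *)
apply: (@ww_of_mass n T _ (fun (D : {set 'I_n}) G => (#|D| == k) && dominates D G)
  (fun D x y => (#|D| == k) && same_spokes D x y) (n * k ^ 2) a) => //.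
- by move=> D A B AB /andP[-> /(dominatesS AB)->].
- move=> D x y A; case: eqP => //= _; exact: dominates_cross.
- move=> D; case: eqP => [<-|_] /=; first exact: sum_same_spokes.
  by rewrite big1 // => x _; rewrite big1.
- by move=> G /copyP[D [Dk domD]]; exists D; rewrite Dk eqxx.
rewrite /mass; under eq_bigr do rewrite set0U.
have cB : #|board n| + 2 <= n ^ 2.
  by rewrite card_draws card_ord bin2 -mulnn;
    case: n n1 {nka small copyP T} => // n; nia.
have := sum_dominating n k; set m := \sum_(S in _) _ => mle.
have powle : (#|board n| + 2) ^ (4 * a) <= (n ^ 2) ^ (4 * a).
  by rewrite leq_exp2r //; lia.
have q0 : 0 < 2 ^ (k * (n - k)) by rewrite expn_gt0.
have b0 : 0 < 2 ^ #|board n| by rewrite expn_gt0.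
rewrite -(ltn_pmul2l q0).
apply: leq_ltn_trans (_ : _ <= (m * 2 ^ (k * (n - k))) * (n ^ 2) ^ (4 * a)) _.
  by rewrite mulnA [X in X * _]mulnC leq_mul2l powle orbT.
apply: leq_ltn_trans (leq_mul mle (leqnn _)) _.
by rewrite mulnAC ltn_pmul2r.
Qed.

(** * The heap-shaped tree *)

Definition parent (n q : nat) (i : 'I_n) : 'I_n :=
  Ordinal (leq_ltn_trans (leq_div i q) (ltn_ord i)).

(** Parents by plain division make [parent q i < k] equivalent to [i < k * q]. The price is that 0
    is its own parent, hence the restriction [0 < i]. *)
Definition heap_tree (n q : nat) : {set {set 'I_n}} :=
  [set [set i; parent q i] | i : 'I_n & 0 < i].

Lemma ltn_parent n q (i : 'I_n) : 1 < q -> 0 < i -> parent q i < i.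
Proof. by move=> q1 i0; rewrite /= ltn_Pdiv. Qed.

Lemma adj_parent n q (i : 'I_n) : 1 < q -> 0 < i ->
  adj (heap_tree n q) i (parent q i).
Proof.
move=> q1 i0; apply/andP; split; last first.
  by apply: (imset_f (fun i => [set i; parent q i])); rewrite inE.
by rewrite -val_eqE neq_ltn ltn_parent // orbT.
Qed.

Lemma adj_sym n (E : {set {set 'I_n}}) : symmetric (adj E).
Proof. by move=> x y; rewrite /adj eq_sym setUC. Qed.

Lemma adj_heap_tree n q (x y : 'I_n) : 1 < q ->
  adj (heap_tree n q) x y -> y <= x -> y = parent q x.
Proof.
move=> q1 /andP[xy /imsetP[i]]; rewrite inE => i0 /setP xyi yx.
have lti := ltn_parent q1 i0.
have := xyi x; have := xyi y; rewrite !inE !eqxx orbT /=.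
move=> /esym/orP[/eqP yi|/eqP yp] /esym/orP[/eqP xi|/eqP xp].
- by rewrite xi yi eqxx in xy.
- by rewrite yi xp leqNgt lti in yx.
- by rewrite yp xi.
- by rewrite yp xp eqxx in xy.
Qed.

Lemma heap_tree_connected n q : 1 < q -> connected_graph (heap_tree n q).
Proof.
move=> q1.
have to0 m (x z : 'I_n) : x <= m -> z = 0 :> nat ->
    connect (adj (heap_tree n q)) x z.
  elim: m x => [|m IHm] x xm z0.
    suff -> : x = z by exact: connect0.
    by apply: val_inj; rewrite /= z0; apply/eqP; rewrite -leqn0.
  have [x0|x0] := posnP x; first by apply: IHm; rewrite ?x0.
  apply: connect_trans (connect1 (adj_parent q1 x0)) _.
  by apply: IHm => //; have := ltn_parent q1 x0; move: xm; lia.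
move=> x y; have n0 : 0 < n by apply: leq_ltn_trans (ltn_ord x).
apply: connect_trans (to0 x x (Ordinal n0) (leqnn x) erefl) _.
rewrite (sym_connect_sym (@adj_sym _ _)).
exact: (to0 y y (Ordinal n0) (leqnn y) erefl).
Qed.

(** Both neighbours of the largest label on a cycle are smaller, so both equal its parent, although
    a cycle of length at least 3 has them distinct. *)
Lemma heap_tree_acyclic n q : 1 < q -> acyclic (heap_tree n q).
Proof.
move=> q1 c uc c3; apply/negP => cyc.
have [x0 x0c] : exists x, x \in c.
  by case: c c3 {uc cyc} => // x c _; exists x; rewrite mem_head.
case: (arg_maxnP (fun x : 'I_n => x : nat) x0c) => x xc xmax.
have [i c' rotc] := rot_to xc.
move: cyc uc c3; rewrite -(rot_cycle i) -(rot_uniq i) -(size_rot i c) rotc.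
have {}xmax y : y \in x :: c' -> y <= x by rewrite -rotc mem_rot; apply: xmax.
case: c' rotc xmax => [|y [|z c']] //= _ xmax.
rewrite rcons_path => /and4P[xy _ _ lx] /and3P[_ yc _] _.
have yE := adj_heap_tree q1 xy (xmax y _).
have lE : last z c' = parent q x.
  apply: adj_heap_tree; rewrite 1?adj_sym //.
  by apply: xmax; rewrite !inE -in_cons mem_last !orbT.
by move: yc; rewrite yE ?inE ?eqxx ?orbT // -lE -in_cons mem_last.
Qed.

Lemma heap_tree_is_tree n q : 1 < q -> is_tree (heap_tree n q).
Proof.
move=> q1; split;
  last by split; [exact: heap_tree_connected | exact: heap_tree_acyclic].
apply/subsetP => _ /imsetP[i + ->]; rewrite !inE => i0.
by rewrite cards2 -val_eqE neq_ltn ltn_parent ?orbT.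
Qed.

(** Apart from the edge to its parent, [v] has only edges to children, and these differ modulo
    [q]. *)
Lemma deg_heap_tree n q (v : 'I_n) : 0 < q -> deg (heap_tree n q) v <= q.+1.
Proof.
move=> q0; pose C := [set i : 'I_n | i %/ q == v].
apply: leq_trans (_ : #|[set [set i; parent q i] | i in v |: C]| <= _).
  apply: subset_leq_card; apply/subsetP => e; rewrite inE.
  case/andP=> /imsetP[i _ ->]; rewrite !inE => vi.
  apply: (imset_f (fun i => [set i; parent q i])).
  by rewrite !inE eq_sym; case/orP: vi => [->//|/eqP->]; rewrite eqxx orbT.
apply: leq_trans (leq_imset_card _ _) _; rewrite cardsU1 -add1n.
apply: leq_add; first by case: (_ \in _).
pose f (i : 'I_n) := Ordinal (ltn_pmod i q0).
rewrite -[q]card_ord -(card_in_imset (_ : {in C &, injective f})) ?max_card //.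
move=> i j; rewrite !inE => /eqP iv /eqP jv /(congr1 val) /= ij.
by apply: val_inj; rewrite /= (divn_eq i q) (divn_eq j q) iv jv ij.
Qed.

(** The hubs are the images of the labels below [k]. A copy is spanning, so any other vertex is the
    image of some label, whose parent is below [k] because [n <= k * q]. *)
Lemma heap_tree_copy n q k (G : {set {set 'I_n}}) :
  0 < k -> k <= n -> n <= k * q -> has_copy (heap_tree n q) G ->
  exists D : {set 'I_n}, #|D| = k /\ dominates D G.
Proof.
move=> k0 kn nkq [f [injf copy]].
have q0 : 0 < q by case: q nkq {copy} => //; rewrite muln0; lia.
exists [set f (widen_ord kn j) | j : 'I_k]; split.
  rewrite card_imset ?card_ord // => i j /injf /(congr1 val) /= ij.
  exact: val_inj.
apply/forallP => v; apply/implyP => vD; pose u := invF injf v.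
have fu : f u = v by rewrite f_invF.
have ku : k <= u.
  rewrite leqNgt; apply: contra vD => uk; apply/imsetP; exists (Ordinal uk) => //.
  by rewrite -fu; congr f; apply: val_inj.
have pk : parent q u < k.
  by rewrite /= ltn_divLR //; apply: leq_trans nkq.
apply/set0Pn; exists [set v; f (parent q u)]; rewrite inE; apply/andP; split.
  have := copy [set u; parent q u]; rewrite imsetU1 imset_set1 fu; apply.
  apply: (imset_f (fun i => [set i; parent q i])).
  by rewrite inE (leq_trans k0).
apply: (imset_f (fun d => [set v; d])); apply/imsetP; exists (Ordinal pk) => //.
by congr f; apply: val_inj.
Qed.

(** * Numerical estimates *)

Lemma bin_leq_expn n k : 'C(n, k) <= n ^ k.
Proof.
have ffact_le : n ^_ k <= n ^ k.
  elim: k => [|k IHk]; first by rewrite ffactn0.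
  by rewrite ffactnSr expnSr leq_mul // leq_subr.
by apply: leq_trans ffact_le; rewrite -bin_ffact leq_pmulr // fact_gt0.
Qed.

(** By Bernoulli, each full block of [N] factors [1 - 1 / N] has product at most 1/2; the leftover
    factors are at most 1. *)
Lemma expn_subn1_gain N m : 1 < N -> 2 ^ (m %/ N) * (N - 1) ^ m <= N ^ m.
Proof.
move=> N1; have mono x y e : x <= y -> x ^ e <= y ^ e.
  by case: e => // e xy; rewrite leq_exp2r.
have gain : 2 * (N - 1) ^ N <= N ^ N.
  have N0 : 0 < N - 1 by rewrite subn_gt0.
  have := bernoulli_expn (N - 1) 1 N; rewrite subnK ?(ltnW N1) //.
  rewrite -[2 * _ <= _](leq_pmul2l N0); apply: leq_trans.
  by rewrite mulnCA mulnA mulnC leq_mul2l; apply/orP; right; lia.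
rewrite {2 3}(divn_eq m N) !expnD mulnA ![_ %/ _ * N]mulnC !expnM -expnMn.
by apply: leq_mul; apply: mono; rewrite ?leq_subr.
Qed.

(** Tailored to [hub_count_bounds]: there [l.+1 <= 8 * k + 8] and [k + 8 * a <= 17 * k * 2 ^ l./2],
    and 136 is 8 times 17. *)
Lemma quadratic_le_exp8 k : 5 <= k -> 136 * k * (k + 1) + 1 <= 8 ^ k.
Proof.
elim: k => // k IHk; rewrite ltnS leq_eqVlt => /orP[/eqP <-|k5].
  by rewrite -[8]/(2 ^ 3) -expnM; lia.
have := IHk k5; rewrite expnS; move: (8 ^ k) => u; nia.
Qed.

(** Here [2 ^ k] is at most about [n ^ (1/8)] and [a] is of order [k * sqrt n]. The gain exponent,
    of order at least [n ^ (7/8)], beats the loss exponent, of order [sqrt n] times a power of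
    [log n]. *)
Lemma hub_count_bounds n (l := trunc_log 2 n) (k := l %/ 8)
    (a := 2 ^ (l./2 + 1) * k) : 40 <= l ->
  [/\ 5 <= k, k <= n, n * k ^ 2 <= 4 * a ^ 2, 8 <= a &
  'C(n, k) * (2 ^ k - 1) ^ (n - k) * (n ^ 2) ^ (4 * a) < 2 ^ (k * (n - k))].
Proof.
move=> l40; have n0 : 0 < n by rewrite lt0n; apply: contraTneq l40 => n0; rewrite /l n0.
have k5 : 5 <= k by rewrite leq_divRL.
have ln : 2 ^ l <= n by apply: trunc_logP.
have nl : n < 2 ^ l.+1 by apply: trunc_log_ltn.
have kl : 8 * k <= l by rewrite mulnC leq_divM.
have lk : l < k.+1 * 8 by rewrite -ltn_divLR.
move: l k @a l40 k5 ln nl kl lk => l k a l40 k5 ln nl kl lk.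
have hl : 2 * l./2 <= l by lia.
have lh : l <= 2 * l./2 + 1 by lia.
have k_le2k : k <= 2 ^ k by rewrite ltnW // ltn_expl.
have h0 : 0 < 2 ^ l./2 by rewrite expn_gt0.
(* Base 2 logarithm of the count inequality, with [l.+1] bounding that of [n]. *)
have key : l.+1 * (k + 8 * a) <= (n - k) %/ 2 ^ k.
  rewrite leq_divRL ?expn_gt0 // leq_subRL; last first.
    by apply: leq_trans ln; apply: leq_trans k_le2k _; rewrite leq_exp2l //; lia.
  apply: leq_trans ln; apply: leq_trans (_ : 2 ^ (l./2 + k) * 2 ^ (3 * k) <= _);
    last by rewrite -expnD leq_exp2l //; lia.
  rewrite [2 ^ (3 * k)]expnM -[2 ^ 3]/8.
  have := quadratic_le_exp8 k5; rewrite /a !expnD expn1.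
  move: (8 ^ k) (2 ^ k) k_le2k (2 ^ l./2) h0 => u v kv h h0 ku.
  apply: leq_trans (_ : h * v * (136 * k * (k + 1) + 1) <= _); last first.
    by rewrite leq_mul2l ku orbT.
  have -> : h * v * (136 * k * (k + 1) + 1) =
      h * v + (8 * k + 8) * (17 * k * h) * v by nia.
  apply: leq_add; first by rewrite -[k]mul1n leq_mul.
  rewrite leq_mul2r; apply/orP; right; apply: leq_mul; first lia.
  nia.
split=> //.
- by apply: leq_trans ln; rewrite ltnW //
    (leq_ltn_trans _ (ltn_expl l _)) //; lia.
- rewrite /a expnMn mulnA leq_mul2r; apply/orP; right; apply: ltnW.
  apply: leq_trans nl _; rewrite -expnM -[4]/(2 ^ 2) -expnD leq_exp2l //; lia.
- rewrite /a addn1 expnS; nia.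
have lt1 : n ^ (k + 8 * a) < 2 ^ ((n - k) %/ 2 ^ k).
  apply: leq_trans (_ : 2 ^ (l.+1 * (k + 8 * a)) <= _); last by rewrite leq_exp2l.
  by rewrite expnM ltn_exp2r //; lia.
have N1 : 1 < 2 ^ k by rewrite -[1]/(2 ^ 0) ltn_exp2l //; lia.
(* With [N = 2 ^ k] the power of [2 ^ k - 1] cancels, leaving [lt1]. *)
rewrite [2 ^ (k * _)]expnM; apply: leq_trans (expn_subn1_gain _ N1).
rewrite -expnM mulnAC ltn_pmul2r ?expn_gt0 ?subn_gt0 ?N1 //.
apply: leq_ltn_trans lt1; rewrite expnD [2 * _]mulnA.
by rewrite leq_mul2r bin_leq_expn orbT.
Qed.

(** Uses only [2 <= exp 1], so that [n < 2 ^ m] gives [n < exp m]. *)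
Lemma ln_le_succ_trunc_log n : 0 < n -> (ln (INR n) <= INR (trunc_log 2 n).+1)%R.
Proof.
move=> n0; rewrite -[X in (_ <= X)%R]ln_exp.
have exp2 m : (INR (2 ^ m) <= exp (INR m))%R.
  elim: m => [|m IHm]; first by rewrite expn0 exp_0 /=; lra.
  rewrite expnS mult_INR (S_INR m) [(INR m + 1)%R]Rplus_comm exp_plus; apply: Rmult_le_compat => //.
  - exact: pos_INR.
  - exact: pos_INR.
  - by have := exp_ineq1_le 1; rewrite /=; lra.
apply/Rlt_le/ln_increasing; first by apply: lt_0_INR; lia.
apply: Rlt_le_trans (exp2 _); apply: lt_INR.
by have := trunc_log_ltn n (isT : 1 < 2); lia.
Qed.

Theorem theorem1p4 :
  exists (c : R) (n0 : nat), (0 < c)%R /\ (0 < n0)%N /\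
    forall n : nat, (n0 <= n)%N ->
      exists T : {set {set 'I_n}},
        is_tree T /\
        (forall v : 'I_n, (INR (deg T v) <= c * INR n / ln (INR n))%R) /\
        waiter_wins T.
Proof.
(* The constant is 3 times 16, from [degk] and [lnk]; the threshold makes [trunc_log 2 n] at least
   40. *)
exists 48%R, (2 ^ 40); split; first lra; split; first by rewrite expn_gt0.
move=> n /(trunc_log_max (isT : 1 < 2)) /hub_count_bounds[].
set k := _ %/ 8; set a := _ * k => k5 kn nka a8 small.
have k0 : 0 < k by apply: leq_trans k5.
(* Rounding up ensures [n <= k * q], so every label has its parent among the [k] hubs. *)
pose q := (n %/ k).+1.
have q1 : 1 < q by rewrite ltnS divn_gt0.
have nkq : n <= k * q by rewrite ltnW // mulnC -ltn_divLR.
have n1 : 1 < n by apply: leq_trans kn; apply: leq_trans k5.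
exists (heap_tree n q); split; first exact: heap_tree_is_tree.
split; last first.
  by apply: (waiter_wins_of_dominating n1 nka a8 small) => G;
    apply: heap_tree_copy.
move=> v; have degv := deg_heap_tree v (ltnW q1).
have degk : deg (heap_tree n q) v * k <= 3 * n.
  apply: leq_trans (leq_mul degv (leqnn k)) _.
  by have := leq_divM n k; rewrite /q; lia.
have lnk : (ln (INR n) <= 16 * INR k)%R.
  apply: Rle_trans (ln_le_succ_trunc_log (ltnW n1)) _.
  have -> : (16 = INR 16)%R by rewrite /=; lra.
  rewrite -mult_INR; apply: le_INR.
  have : trunc_log 2 n < k.+1 * 8 by rewrite -ltn_divLR.
  by lia.
have ln0 : (0 < ln (INR n))%R.
  by rewrite -ln_1; apply: ln_increasing; [lra | apply: lt_1_INR; lia].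
apply: (Rmult_le_reg_r (ln (INR n))) => //.
rewrite /Rdiv Rmult_assoc Rinv_l ?Rmult_1_r; last lra.
apply: Rle_trans (Rmult_le_compat_l _ _ _ (pos_INR _) lnk) _.
have : (INR (deg (heap_tree n q) v) * INR k <= INR 3 * INR n)%R.
  by rewrite -!mult_INR; apply: le_INR; lia.
rewrite [INR 3]/=; lra.
Qed.
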